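(* Let $p$ be a prime. If $p\in\{2,3\}$, then Dedekind sums approximate each $a\in p\mathbb{Z}_p$ (in $\mathbb{Q}_p$). If $p\ge 5$, then Dedekind sums approximate each $a\in\mathbb{Z}_p$ (in $\mathbb{Q}_p$).
   Context: $\mathbb{N}$ denotes the positive integers. For a natural number $n\ge 1$ and an integer $m$ with $\gcd(m,n)=1$, the classical Dedekind sum is $s(m,n)=\sum_{k=1}^n ((k/n))((mk/n))$, where $((t))=t-\lfloor t\rfloor-1/2$ if $t\in\mathbb{R}\setminus\mathbb{Z}$ and $((t))=0$ if $t\in\mathbb{Z}$. Put $S(m,n)=12\,s(m,n)$; this is a rational number and $S(m+n,n)=S(m,n)$. For a prime $p$, $\mathbb{Q}_p$ is the field of $p$-adic numbers and $\mathbb{Z}_p$ the ring of $p$-adic integers. For $a\in\mathbb{Q}_p$ and a subset $M\subseteq\mathbb{Q}_p$, we say that $M$ approximates $a$ (in $\mathbb{Q}_p$) if for every integer $k\ge 1$ there are $x\in M$ and $b\in\mathbb{Z}_p$ with $a=x+p^k b$. ''Dedekind sums approximate $a$ (in $\mathbb{Q}_p$)'' means that the set $M=\{S(m,n): n\in\mathbb{N},\ 0\le m<n,\ \gcd(m,n)=1\}$ approximates $a$ in $\mathbb{Q}_p$. *)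

(* Defs.v *)
From HB Require Import structures.
From mathcomp Require Import all_boot all_order all_algebra.
From mathcomp Require Import boolp classical_sets.

Set Implicit Arguments.
Unset Strict Implicit.
Unset Printing Implicit Defensive.

Import Order.TTheory GRing.Theory Num.Theory.
Local Open Scope classical_set_scope.
Local Open Scope ring_scope.

(* Z_p as the inverse limit of the rings Z / p^k Z: [residue x k] is the
   representative of x modulo p^k in [0, p^k). The range condition is implied
   by [residue_mod], since p > 0. *)
Record padic_int (p : nat) (p_pr : prime p) := PadicInt {
  residue : nat -> int;
  residue_mod : forall k, residue k = (residue k.+1 %% (p ^ k)%N)%Z
}.

HB.instance Definition _ (p : nat) (p_pr : prime p) :=
  gen_eqMixin (padic_int p_pr).
HB.instance Definition _ (p : nat) (p_pr : prime p) :=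
  gen_choiceMixin (padic_int p_pr).

Lemma padic_int_eq (p : nat) (p_pr : prime p) (x y : padic_int p_pr) :
  (forall k, residue x k = residue y k) -> x = y.
Proof.
case: x y => [u hu] [v hv] /= /funext uv.
by move: hv; rewrite -uv => hv; congr PadicInt; exact: Prop_irrelevance.
Qed.

Lemma residue_small (p : nat) (p_pr : prime p) (x : padic_int p_pr) k :
  (residue x k %% (p ^ k)%N)%Z = residue x k.
Proof. by rewrite [in RHS]residue_mod [in LHS]residue_mod modz_mod. Qed.

Lemma modz_pow_le (p i j : nat) (m : int) :
  (i <= j)%N -> ((m %% (p ^ j)%N)%Z = m %[mod (p ^ i)%N])%Z.
Proof.
move=> /subnK e; rewrite [in RHS](divz_eq m (p ^ j)%N).
have -> : (p ^ j)%N%:Z = (p ^ (j - i))%N%:Z * (p ^ i)%N.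
  by rewrite -PoszM -expnD e.
by rewrite mulrA modzMDl.
Qed.

Lemma residue_le (p : nat) (p_pr : prime p) (x : padic_int p_pr) i j :
  (i <= j)%N -> (residue x j %% (p ^ i)%N)%Z = residue x i.
Proof.
move=> /subnK <-; elim: (j - i)%N => [|n IHn]; first exact: residue_small.
by rewrite -IHn [in RHS]residue_mod modz_pow_le // leq_addl.
Qed.

Lemma padic_of_mod (p : nat) (u : nat -> int)
    (hu : forall k, (u k.+1 = u k %[mod (p ^ k)%N])%Z) k :
  (u k %% (p ^ k)%N)%Z = ((u k.+1 %% (p ^ k.+1)%N)%Z %% (p ^ k)%N)%Z.
Proof. by rewrite modz_pow_le. Qed.

Definition padic_of (p : nat) (p_pr : prime p) (u : nat -> int)
    (hu : forall k, (u k.+1 = u k %[mod (p ^ k)%N])%Z) : padic_int p_pr :=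
  PadicInt p_pr (padic_of_mod hu).

Lemma residue_succ (p : nat) (p_pr : prime p) (x : padic_int p_pr) k :
  (residue x k.+1 = residue x k %[mod (p ^ k)%N])%Z.
Proof. by rewrite residue_small -residue_mod. Qed.

Lemma padic_int_const_subproof (p : nat) (m : int) (k : nat) :
  (m = m %[mod (p ^ k)%N])%Z.
Proof. by []. Qed.

Lemma padic_int_add_subproof (p : nat) (p_pr : prime p)
    (x y : padic_int p_pr) k :
  (residue x k.+1 + residue y k.+1 = residue x k + residue y k
    %[mod (p ^ k)%N])%Z.
Proof. by rewrite -modzDm !residue_succ modzDm. Qed.

Lemma padic_int_opp_subproof (p : nat) (p_pr : prime p)
    (x : padic_int p_pr) k :
  (- residue x k.+1 = - residue x k %[mod (p ^ k)%N])%Z.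
Proof. by rewrite -modzNm residue_succ modzNm. Qed.

Lemma padic_int_mul_subproof (p : nat) (p_pr : prime p)
    (x y : padic_int p_pr) k :
  (residue x k.+1 * residue y k.+1 = residue x k * residue y k
    %[mod (p ^ k)%N])%Z.
Proof. by rewrite -modzMm !residue_succ modzMm. Qed.

Definition padic_int_const (p : nat) (p_pr : prime p) (m : int) :=
  padic_of p_pr (padic_int_const_subproof p m).
Definition padic_int_add (p : nat) (p_pr : prime p) (x y : padic_int p_pr) :=
  padic_of p_pr (padic_int_add_subproof x y).
Definition padic_int_opp (p : nat) (p_pr : prime p) (x : padic_int p_pr) :=
  padic_of p_pr (padic_int_opp_subproof x).
Definition padic_int_mul (p : nat) (p_pr : prime p) (x y : padic_int p_pr) :=
  padic_of p_pr (padic_int_mul_subproof x y).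

Lemma padic_int_addA (p : nat) (p_pr : prime p) :
  associative (@padic_int_add p p_pr).
Proof.
by move=> x y z; apply: padic_int_eq => k /=; rewrite modzDml modzDmr addrA.
Qed.

Lemma padic_int_addC (p : nat) (p_pr : prime p) :
  commutative (@padic_int_add p p_pr).
Proof. by move=> x y; apply: padic_int_eq => k /=; rewrite addrC. Qed.

Lemma padic_int_add0 (p : nat) (p_pr : prime p) :
  left_id (padic_int_const p_pr 0) (@padic_int_add p p_pr).
Proof.
by move=> x; apply: padic_int_eq => k /=; rewrite modzDml add0r residue_small.
Qed.

Lemma padic_int_addN (p : nat) (p_pr : prime p) :
  left_inverse (padic_int_const p_pr 0) (@padic_int_opp p p_pr)
    (@padic_int_add p p_pr).
Proof.
by move=> x; apply: padic_int_eq => k /=; rewrite modzDml addNr.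
Qed.

HB.instance Definition _ (p : nat) (p_pr : prime p) :=
  GRing.isZmodule.Build (padic_int p_pr) (@padic_int_addA p p_pr)
    (@padic_int_addC p p_pr) (@padic_int_add0 p p_pr) (@padic_int_addN p p_pr).

Lemma padic_int_mulA (p : nat) (p_pr : prime p) :
  associative (@padic_int_mul p p_pr).
Proof.
by move=> x y z; apply: padic_int_eq => k /=; rewrite modzMml modzMmr mulrA.
Qed.

Lemma padic_int_mulC (p : nat) (p_pr : prime p) :
  commutative (@padic_int_mul p p_pr).
Proof. by move=> x y; apply: padic_int_eq => k /=; rewrite mulrC. Qed.

Lemma padic_int_mul1 (p : nat) (p_pr : prime p) :
  left_id (padic_int_const p_pr 1) (@padic_int_mul p p_pr).
Proof.
by move=> x; apply: padic_int_eq => k /=; rewrite modzMml mul1r residue_small.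
Qed.

Lemma padic_int_mulDl (p : nat) (p_pr : prime p) :
  left_distributive (@padic_int_mul p p_pr) (@padic_int_add p p_pr).
Proof.
move=> x y z; apply: padic_int_eq => k /=.
by rewrite modzMml modzDm mulrDl.
Qed.

Lemma padic_int_const1_neq0 (p : nat) (p_pr : prime p) :
  padic_int_const p_pr 1 != padic_int_const p_pr 0.
Proof.
apply/eqP => /(congr1 (fun x => residue x 1)) /=.
by rewrite expn1 !modz_nat mod0n modn_small // prime_gt1.
Qed.

HB.instance Definition _ (p : nat) (p_pr : prime p) :=
  GRing.Zmodule_isComNzRing.Build (padic_int p_pr) (@padic_int_mulA p p_pr)
    (@padic_int_mulC p p_pr) (@padic_int_mul1 p p_pr)
    (@padic_int_mulDl p p_pr) (@padic_int_const1_neq0 p p_pr).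

Definition padic_int_unit (p : nat) (p_pr : prime p) : {pred padic_int p_pr} :=
  fun x => `[< exists y, y * x = 1 >].

(* Any inverse of a unit; x itself when x is not a unit, as required by the
   unit ring interface. *)
Definition padic_int_inv (p : nat) (p_pr : prime p) (x : padic_int p_pr) :
    padic_int p_pr :=
  xget x [set y | y * x = 1].

Lemma padic_int_mulVx (p : nat) (p_pr : prime p) :
  {in @padic_int_unit p p_pr, left_inverse 1 (@padic_int_inv p p_pr) *%R}.
Proof. by move=> x /asboolP[y yx]; exact: (@xgetI _ x [set z | z * x = 1] y yx). Qed.

Lemma padic_int_unitPl (p : nat) (p_pr : prime p) (x y : padic_int p_pr) :
  y * x = 1 -> padic_int_unit x.
Proof. by move=> yx; apply/asboolP; exists y. Qed.

Lemma padic_int_inv_out (p : nat) (p_pr : prime p) :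
  {in [predC @padic_int_unit p p_pr], @padic_int_inv p p_pr =1 id}.
Proof.
move=> x /asboolPn nx; rewrite /padic_int_inv; case: xgetP => //= y _ yx.
by case: nx; exists y.
Qed.

HB.instance Definition _ (p : nat) (p_pr : prime p) :=
  GRing.ComNzRing_hasMulInverse.Build (padic_int p_pr)
    (@padic_int_mulVx p p_pr) (@padic_int_unitPl p p_pr)
    (@padic_int_inv_out p p_pr).

Lemma padic_int_neq0 (p : nat) (p_pr : prime p) (x : padic_int p_pr) :
  x != 0 -> exists k, ~~ ((p ^ k)%N %| residue x k)%Z.
Proof.
move=> x0; apply: contrapT => nx; move/negP: x0; apply; apply/eqP.
apply: padic_int_eq => k /=; rewrite mod0z -residue_small; apply/dvdz_mod0P.
by apply: contraT => kx; case: nx; exists k.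
Qed.

Lemma padic_int_integral (p : nat) (p_pr : prime p) :
  GRing.integral_domain_axiom (padic_int p_pr).
Proof.
move=> x y xy0; apply: contraT; rewrite negb_or => /andP[].
move=> /padic_int_neq0[i xi] /padic_int_neq0[j yj].
have : ((p ^ (i + j))%N %| residue x (i + j) * residue y (i + j))%Z.
  apply/dvdz_mod0P; move: xy0 => /(congr1 (fun z => residue z (i + j))) /= ->.
  by rewrite mod0z.
move: xi yj; rewrite -(residue_le x (leq_addr j i)).
rewrite -(residue_le y (leq_addl i j)).
move=> xi yj.
have {}xi : ~~ ((p ^ i)%N %| residue x (i + j))%Z.
  by apply: contra xi => /dvdz_mod0P ->; rewrite dvdz0.
have {}yj : ~~ ((p ^ j)%N %| residue y (i + j))%Z.
  by apply: contra yj => /dvdz_mod0P ->; rewrite dvdz0.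
move: xi yj; rewrite !dvdzE /= abszM.
move: `|residue x _|%N `|residue y _|%N => a b ia jb ijab.
have a0 : (0 < a)%N by case: a ia {ijab} => //; rewrite dvdn0.
have b0 : (0 < b)%N by case: b jb {ijab} => //; rewrite dvdn0.
move: ia jb ijab; rewrite !pfactor_dvdn ?muln_gt0 ?a0 ?b0 // lognM //.
rewrite -!ltnNge => ai bj; rewrite leqNgt => /negP[].
by rewrite -addSn leq_add // ltnW.
Qed.

HB.instance Definition _ (p : nat) (p_pr : prime p) :=
  GRing.ComUnitRing_isIntegral.Build (padic_int p_pr)
    (@padic_int_integral p p_pr).

Definition padic (p : nat) (p_pr : prime p) := {fraction (padic_int p_pr)}.

Lemma residue_natr (p : nat) (p_pr : prime p) (n k : nat) :
  residue (n%:R : padic_int p_pr) k = (n %% p ^ k)%N.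
Proof.
elim: n => [|n IHn]; first by rewrite mod0n /= mod0z.
by rewrite mulrSr /= IHn !modz_nat modnDm addn1.
Qed.

Lemma padic_pchar (p : nat) (p_pr : prime p) : [pchar (padic p_pr)] =i pred0.
Proof.
move=> q; apply/negbTE; rewrite inE negb_and.
have [q_pr /=|//] := boolP (prime q).
rewrite -(rmorph_nat (@FracField.tofrac (padic_int p_pr))) tofrac_eq0.
apply/eqP => /(congr1 (fun z => residue z q)).
have q_lt : (q < p ^ q)%N by rewrite ltn_expl // prime_gt1.
rewrite residue_natr (modn_small q_lt).
have -> : residue (0 : padic_int p_pr) q = 0 by rewrite /= mod0z.
by move=> /eqP; rewrite eqz_nat => /eqP q0; move: q_pr; rewrite q0.
Qed.

Definition padic_integers (p : nat) (p_pr : prime p) : set (padic p_pr) :=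
  range (@FracField.tofrac (padic_int p_pr)).
Arguments padic_integers {p} p_pr.

Definition approximates (p : nat) (p_pr : prime p) (M : set (padic p_pr))
    (a : padic p_pr) : Prop :=
  forall k : nat, (1 <= k)%N ->
    exists x b, [/\ M x, padic_integers p_pr b & a = x + p%:R ^+ k * b].

(* All the arguments of ((.)) in a Dedekind sum are rational. *)
Definition sawtooth (t : rat) : rat :=
  if t \is a Num.int then 0 else t - (Num.floor t)%:~R - 2^-1.

Definition dedekind_sum (m : int) (n : nat) : rat :=
  \sum_(1 <= k < n.+1)
    sawtooth (k%:R / n%:R) * sawtooth (m%:~R * k%:R / n%:R).

Definition normalized_dedekind_sum (m : int) (n : nat) : rat :=
  12 * dedekind_sum m n.

Definition dedekind_sum_values : set rat :=
  [set S | exists (n : nat) (m : int),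
     [/\ (0 < n)%N, 0 <= m < n%:Z, coprimez m n
       & S = normalized_dedekind_sum m n]].

(* [ratr] is the field embedding of Q into Q_p, by [padic_pchar]. *)
Definition dedekind_sums_approximate (p : nat) (p_pr : prime p)
    (a : padic p_pr) : Prop :=
  approximates [set ratr q | q in dedekind_sum_values] a.

(* Main.v *)
Require Import Defs.
From mathcomp Require Import all_boot all_order all_algebra.
From mathcomp Require Import boolp classical_sets.
From mathcomp Require Import ring lra zify.
Import Order.TTheory GRing.Theory Num.Theory.
Local Open Scope classical_set_scope.
Local Open Scope ring_scope.

(** Two explicit families of Dedekind sums are enough. By the reciprocity law
    [S(m, n) + S(n, m) = m / n + n / m + 1 / (m n) - 3], proved in
    [dedekind_reciprocity], the value [S(m, n)] can be read off the Euclidean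
    algorithm: [S(1, n) = n - 3 + 2 / n], and for [n / m = a - 1 / (b - 1 / c)]
    one finds [S(m, n) = a + b + c - 9 + (a b + b c - 2) / n] with
    [n = a b c - a - c].

    Multiples of [p]. With [n = t + 1] the first formula reads
    [S(1, n) = t (t - 1) / (t + 1)]. To obtain a value [A] divisible by [p] one
    solves [t = t ^ 2 - A (1 + t)], and the right-hand side is a contraction of
    [p Z_p]. So the values [S(1, n)] approximate every element of [p Z_p],
    which settles the primes 2 and 3.

    Primes from 5 on. In the second formula take [a = 2] and let [b] tend
    p-adically to 1 / 2. Then [n = (2 b - 1) c - 2] tends to -2, whatever [c],
    because 2 - 1 / b tends to 0, and the Dedekind sum tends to [3 c / 4 - 6].
    The slope is [1 - 1 / 4], with 1 coming from [a + b + c] and -1 / 4 from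
    [b c / n]; it is a unit exactly because [p] is neither 2 nor 3, so the
    limit takes all values in [Z_p].

    The reciprocity law itself follows from two facts about the floors of
    [m k / n]: multiplication by [m] permutes the residues modulo [n]
    ([sum_modn_perm]), and the lattice points of a triangle can be counted by
    rows or by columns ([floor_triangle_count]). *)

Set Implicit Arguments.
Unset Strict Implicit.
Unset Printing Implicit Defensive.

(** * The sawtooth function *)

Lemma sawtoothDz (z : int) (t : rat) : sawtooth (z%:~R + t) = sawtooth t.
Proof.
rewrite /sawtooth; have zint : (z%:~R : rat) \is a Num.int by exact: intr_int.
rewrite rpredDl //; case: ifP => // _.
by rewrite floorDzr // intrKfloor rmorphD /= opprD addrACA subrr add0r.
Qed.

Lemma sawtooth_frac (f : rat) : 0 < f < 1 -> sawtooth f = f - 2^-1.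
Proof.
move=> /andP[f0 f1]; rewrite /sawtooth.
have -> : Num.floor f = 0 by apply: floor_def; rewrite /= ltW.
case: ifP => [/intrP[z fz]|_]; last by rewrite subr0.
by move: f0 f1; rewrite fz ltr0z -[1]/(1%:~R) ltr_int; lia.
Qed.

Lemma sawtooth_int (z : int) : sawtooth z%:~R = 0.
Proof. by rewrite /sawtooth intr_int. Qed.

Lemma sawtoothN (t : rat) : sawtooth (- t) = - sawtooth t.
Proof.
have [/intrP[z ->]|tN] := boolP (t \is a Num.int).
  by rewrite -mulrNz !sawtooth_int oppr0.
have fr : 0 < t - (Num.floor t)%:~R < 1.
  rewrite subr_gt0 lt_neqAle floor_le andbT ltrBlDl.
  have -> : t < (Num.floor t)%:~R + 1.
    by have := floorD1_gt t; rewrite rmorphD.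
  by rewrite andbT; apply: contra tN => /eqP <-; exact: intr_int.
have -> : - t = (- Num.floor t - 1)%:~R + (1 - (t - (Num.floor t)%:~R)).
  by rewrite intrB mulrNz; ring.
have -> : sawtooth t = sawtooth (t - (Num.floor t)%:~R).
  by rewrite -[in LHS](subrKC (Num.floor t)%:~R t) sawtoothDz.
rewrite sawtoothDz !sawtooth_frac //; last by lra.
by field.
Qed.

Lemma dedekind_sumN (m : int) (n : nat) :
  dedekind_sum (- m) n = - dedekind_sum m n.
Proof.
rewrite /dedekind_sum -sumrN; apply: eq_bigr => k _.
by rewrite mulrNz !mulNr sawtoothN mulrN.
Qed.

Lemma dedekind_sumDmul (m q : int) (n : nat) : (0 < n)%N ->
  dedekind_sum (q * n%:Z + m) n = dedekind_sum m n.
Proof.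
move=> n0; rewrite /dedekind_sum; apply: eq_bigr => k _; congr (_ * _).
rewrite -[in RHS](sawtoothDz (q * k%:Z)); congr sawtooth.
have n0' : n%:R != 0 :> rat by rewrite pnatr_eq0 -lt0n.
by rewrite rmorphD !intrM -!pmulrn; field.
Qed.

Lemma sawtooth_ratio (k n : nat) : (0 < n)%N -> ~~ (n %| k)%N ->
  sawtooth (k%:R / n%:R) = (k %% n)%:R / n%:R - 2^-1.
Proof.
move=> n0 nk; have n0' : (0 : rat) < n%:R by rewrite ltr0n.
have -> : k%:R / n%:R = (k %/ n)%N%:Z%:~R + (k %% n)%:R / n%:R :> rat.
  rewrite [in LHS](divn_eq k n) natrD natrM -pmulrn; field.
  by rewrite pnatr_eq0 -lt0n.
rewrite sawtoothDz sawtooth_frac // divr_gt0 ?ltr0n //=; last by rewrite lt0n.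
by rewrite ltr_pdivrMr // mul1r ltr_nat ltn_pmod.
Qed.

(** * Dedekind sums and floor moments *)

(** Multiplication by [m] permutes the residues modulo [n]. *)
Lemma sum_modn_perm (R : nmodType) (m n : nat) (F : nat -> R) :
  coprime m n -> \sum_(k < n) F ((m * k) %% n)%N = \sum_(k < n) F k.
Proof.
case: n => [|n] mn; first by rewrite !big_ord0.
pose h (k : 'I_n.+1) := Ordinal (ltn_pmod (m * k) (ltn0Sn n)).
rewrite [RHS](reindex_inj (h := h)) // => i j /(congr1 val) /= /eqP.
wlog ij : i j / (i <= j)%N => [W|].
  by case/orP: (leq_total i j) => H E; [|symmetry];
      apply: W => //; rewrite eq_sym.
rewrite eq_sym eqn_mod_dvd ?leq_mul2l ?ij ?orbT // -mulnBr.
rewrite Gauss_dvdr; last first.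
  by rewrite coprime_sym.
move=> /dvdnP[q qE]; apply: val_inj => /=; have := ltn_ord j.
by case: q qE => [|q]; nia.
Qed.

Lemma natr_modn_mul (m n k : nat) :
  ((m * k) %% n)%:R = m%:R * k%:R - n%:R * ((m * k) %/ n)%:R :> rat.
Proof.
by rewrite -!natrM [in X in _ = X - _](divn_eq (m * k) n) natrD mulnC; ring.
Qed.

Lemma sum_id (n : nat) : \sum_(k < n) k%:R = n%:R * (n%:R - 1) / 2 :> rat.
Proof.
elim: n => [|n IH]; first by rewrite big_ord0 !mul0r.
by rewrite big_ord_recr /= IH -natr1; field.
Qed.

Lemma sum_sqr (n : nat) : \sum_(k < n) k%:R ^+ 2 =
  n%:R * (n%:R - 1) * (2 * n%:R - 1) / 6 :> rat.
Proof.
elim: n => [|n IH]; first by rewrite big_ord0 !mul0r.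
by rewrite big_ord_recr /= IH -natr1; field.
Qed.

(** The only part of a Dedekind sum without an elementary closed form. *)
Definition floor_moment (m n : nat) : rat :=
  \sum_(k < n) k%:R * ((m * k) %/ n)%:R.

(** Writing [(m k mod n) / n = m k / n - floor (m k / n)] and expanding the
    product turns everything but the floor moment into power sums. *)
Lemma dedekind_sum_floor_moment (m n : nat) : (0 < n)%N -> coprime m n ->
  dedekind_sum m n =
    m%:R * (n%:R - 1) * (2 * n%:R - 1) / (6 * n%:R)
      - floor_moment m n / n%:R - (n%:R - 1) / 4.
Proof.
move=> n0 mn; have n0' : n%:R != 0 :> rat by rewrite pnatr_eq0 -lt0n.
have -> : dedekind_sum m n = \sum_(k < n) (k%:R / n%:R - 2^-1)
    * (((m * k) %% n)%:R / n%:R - 2^-1) - 4^-1.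
  (* The term [k = n] vanishes; the term [k = 0] on the right is 1 / 4. *)
  rewrite /dedekind_sum -(big_mkord xpredT (fun k => (k%:R / n%:R - 2^-1)
    * (((m * k) %% n)%:R / n%:R - 2^-1))) big_nat_recr //= [RHS]addrC.
  rewrite [in RHS]big_ltn // muln0 mod0n mul0r divff // -[1]/(1%:~R).
  rewrite sawtooth_int.
  rewrite mul0r addr0 sub0r mulrNN addrA.
  have -> : - 4^-1 + 2^-1 * 2^-1 = 0 :> rat by field.
  rewrite add0r; apply: eq_big_nat => k /andP[k0 kn].
  have nk : ~~ (n %| k)%N by rewrite gtnNdvd.
  rewrite -pmulrn -natrM !sawtooth_ratio // ?(modn_small kn) //.
  by rewrite Gauss_dvdr // coprime_sym.
have -> : \sum_(k < n) (k%:R / n%:R - 2^-1)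
    * (((m * k) %% n)%:R / n%:R - 2^-1) =
    m%:R / n%:R ^+ 2 * \sum_(k < n) k%:R ^+ 2 - n%:R^-1 * floor_moment m n
    - (2 * n%:R)^-1 * (\sum_(k < n) k%:R + \sum_(k < n) ((m * k) %% n)%:R)
    + 4^-1 * \sum_(k < n) 1.
  rewrite /floor_moment -big_split /= !mulr_sumr -!sumrB -big_split /=.
  by apply: eq_bigr => k _; rewrite natr_modn_mul; field.
rewrite (sum_modn_perm (fun k => k%:R : rat) mn) sum_id sum_sqr.
rewrite sumr_const card_ord.
by field.
Qed.

(** * The reciprocity law *)

(** The residues [m k mod n] have the same sum as the [k < n]. *)
Lemma sum_floor (m n : nat) : (0 < n)%N -> coprime m n ->
  \sum_(k < n) ((m * k) %/ n)%:R = (m%:R - 1) * (n%:R - 1) / 2 :> rat.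
Proof.
move=> n0 mn; have n0' : n%:R != 0 :> rat by rewrite pnatr_eq0 -lt0n.
have := sum_modn_perm (fun k => k%:R : rat) mn.
under eq_bigr do rewrite natr_modn_mul.
rewrite sumrB -!mulr_sumr sum_id => E; apply: (mulfI n0').
by lra.
Qed.

(** The residues [m k mod n] have the same sum of squares as the [k < n]. *)
Lemma floor_moment_sqr (m n : nat) : (0 < n)%N -> coprime m n ->
  2 * m%:R * n%:R * floor_moment m n =
    (m%:R ^+ 2 - 1) * (n%:R * (n%:R - 1) * (2 * n%:R - 1) / 6)
      + n%:R ^+ 2 * \sum_(k < n) ((m * k) %/ n)%:R ^+ 2.
Proof.
move=> n0 mn; have := sum_modn_perm (fun k => k%:R ^+ 2 : rat) mn.
rewrite sum_sqr => E; rewrite mulrBl mul1r -[X in _ - X]E -sum_sqr.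
rewrite /floor_moment !mulr_sumr -sumrB -big_split /=; apply: eq_bigr => k _.
by rewrite natr_modn_mul; ring.
Qed.

(** Both sides sum [j] over the pairs [(k, j)] with [k < n], [j < m] and
    [j n <= m k], by rows on the left and by columns on the right. By
    coprimality no such pair with [0 < j] lies on the diagonal [j n = m k],
    and the condition reads [floor (n j / m) < k]. *)
Lemma floor_triangle_count (m n : nat) :
  (0 < m)%N -> (0 < n)%N -> coprime m n ->
  (\sum_(k < n) \sum_(j < ((m * k) %/ n).+1) j =
   \sum_(j < m) j * (n.-1 - (n * j) %/ m))%N.
Proof.
move=> m0 n0 mn.
transitivity (\sum_(k < n) \sum_(j < m | j * n <= m * k) j)%N.
  apply: eq_bigr => k _; have qm : ((m * k) %/ n < m)%N.
    by rewrite ltn_divLR // ltn_pmul2l.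
  rewrite (big_ord_widen m id) //; apply: eq_bigl => j.
  by rewrite ltnS leq_divRL.
rewrite (exchange_big_dep xpredT) //=; apply: eq_bigr => j _.
rewrite sum_nat_const mulnC; case: (posnP j) => [->|j0].
  by rewrite !mul0n.
congr (_ * _)%N.
have qn : ((n * j) %/ m < n)%N by rewrite ltn_divLR // ltn_pmul2l.
rewrite -(card_ord (n.-1 - (n * j) %/ m)).
have f_lt (i : 'I_(n.-1 - (n * j) %/ m)) : (i + ((n * j) %/ m).+1 < n)%N.
  by have := ltn_ord i; lia.
pose f i := Ordinal (f_lt i).
have f_inj : injective f by move=> i i' /(congr1 val) /= /addIn; exact: val_inj.
rewrite -(card_codom f_inj); apply: eq_card => k.
rewrite unfold_in -[LHS]/(j * n <= m * k)%N.
have -> : (j * n <= m * k)%N = ((n * j) %/ m < k)%N.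
  rewrite ltn_divLR // [(k * m)%N]mulnC [(j * n)%N]mulnC leq_eqVlt.
  case: eqP => //= E; have : (m %| j)%N.
    by rewrite -(Gauss_dvdr _ mn) E dvdn_mulr.
  by move=> /(dvdn_leq j0); rewrite leqNgt ltn_ord.
apply/idP/codomP => [kq|[i ->]]; last by rewrite /= addnS ltnS leq_addl.
have i_lt : (k - ((n * j) %/ m).+1 < n.-1 - (n * j) %/ m)%N.
  by have := ltn_ord k; lia.
by exists (Ordinal i_lt); apply: val_inj => /=; rewrite subnK.
Qed.

(** The lattice point count, rewritten with moments: it trades the sum of
    the squares of [floor (m k / n)] for the floor moment with [m] and [n]
    exchanged. *)
Lemma floor_moment_dual (m n : nat) : (0 < m)%N -> (0 < n)%N -> coprime m n ->
  \sum_(k < n) ((m * k) %/ n)%:R ^+ 2 + \sum_(k < n) ((m * k) %/ n)%:R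
    + 2 * floor_moment n m = m%:R * (m%:R - 1) * (n%:R - 1).
Proof.
move=> m0 n0 mn.
have := congr1 (fun x => x%:R : rat) (floor_triangle_count m0 n0 mn).
rewrite !natr_sum.
under eq_bigr do rewrite natr_sum sum_id -natr1.
under [in X in _ = X -> _]eq_bigr => j _.
  have qn : ((n * j) %/ m < n)%N by rewrite ltn_divLR // ltn_pmul2l.
  have -> : (j * (n.-1 - (n * j) %/ m))%:R =
      (n%:R - 1) * j%:R - j%:R * ((n * j) %/ m)%:R :> rat.
    have -> : (n.-1 - (n * j) %/ m = n - ((n * j) %/ m).+1)%N by lia.
    by rewrite natrM natrB // -natr1; ring.
  over.
rewrite sumrB -mulr_sumr sum_id -/(floor_moment n m) => E.
rewrite -big_split /=.
have -> : 2 * floor_moment n m = m%:R * (m%:R - 1) * (n%:R - 1) - 2 *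
   ((n%:R - 1) * (m%:R * (m%:R - 1) / 2) - floor_moment n m) by field.
by rewrite -E mulr_sumr addrCA -sumrB big1 ?addr0 // => k _; field.
Qed.

(** The equality of square sums expresses one floor moment, and the lattice
    point count the other one, through the same sum of squares of floors, which
    cancels in the combination at hand. *)
Lemma dedekind_reciprocity (m n : nat) :
  (0 < m)%N -> (0 < n)%N -> coprime m n ->
  normalized_dedekind_sum m n + normalized_dedekind_sum n m =
    m%:R / n%:R + n%:R / m%:R + (m%:R * n%:R)^-1 - 3.
Proof.
move=> m0 n0 mn; have nm : coprime n m by rewrite coprime_sym.
have m0' : m%:R != 0 :> rat by rewrite pnatr_eq0 -lt0n.
have n0' : n%:R != 0 :> rat by rewrite pnatr_eq0 -lt0n.
rewrite /normalized_dedekind_sum !dedekind_sum_floor_moment //.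
have A := floor_moment_sqr n0 mn; have := floor_moment_dual m0 n0 mn.
rewrite sum_floor // => D.
set B := \sum_(k < n) _ in A D.
have -> : floor_moment m n = ((m%:R ^+ 2 - 1) * (n%:R * (n%:R - 1) *
    (2 * n%:R - 1) / 6) + n%:R ^+ 2 * B) / (2 * m%:R * n%:R).
  by rewrite -A; field; rewrite n0' m0'.
have -> : floor_moment n m = (m%:R * (m%:R - 1) * (n%:R - 1)
   - (B + (m%:R - 1) * (n%:R - 1) / 2)) / 2.
  by rewrite -D; field.
by field; rewrite n0' m0'.
Qed.

(** * Closed formulas *)

(** Reciprocity, since every Dedekind sum with denominator 1 vanishes. *)
Lemma normalized_dedekind_sum1 (n : nat) : (0 < n)%N ->
  normalized_dedekind_sum 1 n = n%:R - 3 + 2 / n%:R.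
Proof.
move=> n0; have := dedekind_reciprocity (ltn0Sn 0) n0 (coprime1n n).
have -> : normalized_dedekind_sum n 1 = 0.
  rewrite /normalized_dedekind_sum /dedekind_sum big_nat1 divr1 -[1]/(1%:~R).
  by rewrite sawtooth_int mul0r mulr0.
by rewrite addr0 => ->; field; rewrite pnatr_eq0 -lt0n.
Qed.

(** Two steps of the Euclidean algorithm with negative remainders. *)
Lemma coprime_cfrac3 (a b c m n : nat) :
  (m + 1 = b * c)%N -> (n + c = a * m)%N -> coprime m n.
Proof.
move=> mE nE; rewrite /coprime -dvdn1.
rewrite -(dvdn_addr _ (dvdn_gcdl m n)) mE dvdn_mull //.
by rewrite -(dvdn_addr _ (dvdn_gcdr m n)) nE dvdn_mull // dvdn_gcdl.
Qed.

(** Here [n / m = a - 1 / (b - 1 / c)]. Reducing [n] modulo [m] and [m]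
    modulo [c] leaves the negatives of smaller residues, so that two
    applications of reciprocity lead down to [S(1, c)]. *)
Lemma normalized_dedekind_sum3 (a b c m n : nat) :
  (0 < c)%N -> (0 < m)%N -> (0 < n)%N ->
  (m + 1 = b * c)%N -> (n + c = a * m)%N ->
  normalized_dedekind_sum m n =
    a%:R + b%:R + c%:R - 9 + (a%:R * b%:R + b%:R * c%:R - 2) / n%:R.
Proof.
move=> c0 m0 n0 mE nE.
have c0' : c%:R != 0 :> rat by rewrite pnatr_eq0 -lt0n.
have m0' : m%:R != 0 :> rat by rewrite pnatr_eq0 -lt0n.
have n0' : n%:R != 0 :> rat by rewrite pnatr_eq0 -lt0n.
have mc : coprime m c.
  have : coprime m (b * c) by rewrite -mE addn1 coprimenS.
  by rewrite coprimeMr => /andP[].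
have mn := coprime_cfrac3 mE nE.
have y1 := normalized_dedekind_sum1 c0.
have R1 := dedekind_reciprocity m0 n0 mn.
have R2 := dedekind_reciprocity m0 c0 mc.
have nmE : normalized_dedekind_sum n m = - normalized_dedekind_sum c m.
  rewrite /normalized_dedekind_sum -mulrN -dedekind_sumN.
  have -> : n%:Z = a%:Z * m%:Z + - c%:Z by rewrite -PoszM -nE PoszD addrK.
  by rewrite dedekind_sumDmul.
have mcE : normalized_dedekind_sum m c = - normalized_dedekind_sum 1 c.
  rewrite /normalized_dedekind_sum -mulrN -dedekind_sumN.
  have -> : m%:Z = b%:Z * c%:Z + - 1 by rewrite -PoszM -mE PoszD addrK.
  by rewrite dedekind_sumDmul.
have E1 : m%:R = b%:R * c%:R - 1 :> rat.
  by rewrite -natrM -mE natrD addrK.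
have E2 : n%:R = a%:R * m%:R - c%:R :> rat.
  by rewrite -natrM -nE natrD addrK.
have -> : normalized_dedekind_sum m n = m%:R / n%:R + n%:R / m%:R
   + (m%:R * n%:R)^-1 - 3 + (m%:R / c%:R + c%:R / m%:R + (m%:R * c%:R)^-1 - 3)
   + (c%:R - 3 + 2 / c%:R).
  by rewrite -R1 -R2 nmE mcE y1; ring.
rewrite E2 E1 in m0' n0' *.
by field; rewrite c0' m0' n0'.
Qed.

(** * Rational approximation of p-adic integers *)

Lemma pchar0_intr_eq0 (F : fieldType) (z : int) :
  [pchar F] =i pred0 -> ((z%:~R : F) == 0) = (z == 0).
Proof.
move=> F0; have nat0 n : ((n%:R : F) == 0) = (n == 0)%N.
  exact: (pcharf0P F).1.
case: z => n; first by rewrite eqz_nat -pmulrn nat0.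
by rewrite NegzE mulrNz oppr_eq0 -pmulrn nat0.
Qed.

(** [ratr q] divides the numerator of [q] by its denominator, whereas [N / D]
    need not be in lowest terms; in characteristic 0 both fractions remain
    equal. *)
Lemma pchar0_ratr_div (F : fieldType) (N D : int) :
  [pchar F] =i pred0 -> D != 0 ->
  ratr (N%:~R / D%:~R) = N%:~R / D%:~R :> F.
Proof.
move=> F0 D0; set q := N%:~R / D%:~R.
have q0 : (denq q)%:~R != 0 :> F by rewrite pchar0_intr_eq0 // denq_neq0.
have D0' : D%:~R != 0 :> F by rewrite pchar0_intr_eq0.
rewrite /ratr; apply/eqP; rewrite eqr_div //; apply/eqP; rewrite -!intrM.
congr (_%:~R); apply/eqP; rewrite -(eqr_int rat) !intrM.
rewrite -eqr_div ?intr_eq0 ?denq_neq0 //.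
by rewrite divq_num_den.
Qed.

Lemma residue_intr (p : nat) (p_pr : prime p) (z : int) k :
  residue (z%:~R : padic_int p_pr) k = (z %% (p ^ k)%N)%Z.
Proof.
case: z => n; first by rewrite -pmulrn residue_natr modz_nat.
by rewrite NegzE mulrNz -pmulrn /= residue_natr -modz_nat modzNm.
Qed.

(** The inverses modulo the powers of [p] are compatible because each of
    them is unique. *)
Lemma padic_int_intr_inv (p : nat) (p_pr : prime p) (D : int) : coprimez D p ->
  exists y : padic_int p_pr, y * D%:~R = 1.
Proof.
move=> Dp; have co k : coprimez D (p ^ k)%N.
  by rewrite coprimezE /= coprimeXr // -coprimezE.
have inv k : {u : int | (u * D = 1 %[mod (p ^ k)%N])%Z}.
  have [u [v uv]] := Bezoutz D (p ^ k)%N.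
  exists u; move/eqP: (co k) => uv1.
  by rewrite -[in RHS]uv1 -uv addrC modzMDl.
pose u k := sval (inv k).
have uD k : (u k * D = 1 %[mod (p ^ k)%N])%Z by exact: svalP (inv k).
have hu k : (u k.+1 = u k %[mod (p ^ k)%N])%Z.
  have uD' : (u k.+1 * D = 1 %[mod (p ^ k)%N])%Z.
    by rewrite -(modz_pow_le _ _ (leqnSn k)) uD modz_pow_le.
  have := uD'; rewrite -(uD k) => /eqP; rewrite eqz_mod_dvd -mulrBl.
  rewrite Gauss_dvdzl; last by rewrite coprimez_sym.
  by rewrite -eqz_mod_dvd => /eqP.
exists (padic_of p_pr hu); apply: padic_int_eq => k.
by rewrite /= residue_intr modzMml modzMmr uD.
Qed.

(** Division by [p ^ k] shifts the sequence of residues by [k] places. *)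
Lemma padic_int_residue0 (p : nat) (p_pr : prime p) (z : padic_int p_pr) k :
  residue z k = 0 -> exists w, z = p%:R ^+ k * w.
Proof.
move=> zk0; have pk0 i : (p ^ i)%N%:Z != 0.
  by rewrite eqz_nat -lt0n expn_gt0 prime_gt0.
have pD i : (p ^ (i + k))%N%:Z = (p ^ i)%N%:Z * (p ^ k)%N.
  by rewrite expnD PoszM.
have zdiv i : ((p ^ k)%N %| residue z (i + k))%Z.
  by apply/dvdz_mod0P; rewrite residue_le // leq_addl.
have hu j : ((residue z (j.+1 + k) %/ (p ^ k)%N)%Z =
    (residue z (j + k) %/ (p ^ k)%N)%Z %[mod (p ^ j)%N])%Z.
  rewrite [in LHS](divz_eq (residue z (j.+1 + k)) (p ^ (j + k))%N).
  rewrite addSn -residue_mod.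
  by rewrite pD mulrA divzMDl // modzMDl.
exists (padic_of p_pr hu); apply: padic_int_eq => j.
rewrite -natrX /= residue_natr -modz_nat modzMml modzMmr mulrC.
by rewrite divzK // residue_le // leq_addr.
Qed.

(** The difference [alpha - N / D] is [(alpha D - N) / D], whose numerator has
    residue 0 modulo [p ^ k] and whose denominator is a unit. *)
Lemma padic_int_approx (p : nat) (p_pr : prime p)
    (alpha : padic_int p_pr) (k : nat) (N D : int) :
  coprimez D p -> (residue alpha k * D = N %[mod (p ^ k)%N])%Z ->
  exists2 b, padic_integers p_pr b &
    FracField.tofrac alpha = ratr (N%:~R / D%:~R) + p%:R ^+ k * b.
Proof.
move=> Dp alphaE; have [y yD] := padic_int_intr_inv p_pr Dp.
have D0 : D != 0.
  apply: contraTneq Dp => ->.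
  by rewrite /coprimez gcd0z /= eqz_nat gtn_eqF // prime_gt1.
have [w wE] : exists w, alpha * D%:~R - N%:~R = p%:R ^+ k * w.
  apply: padic_int_residue0; rewrite /= !residue_intr.
  rewrite modzMmr modzNm modzDm; apply/dvdz_mod0P.
  by rewrite -eqz_mod_dvd alphaE.
exists (FracField.tofrac (w * y)); first by exists (w * y).
have F0 := padic_pchar p_pr; rewrite pchar0_ratr_div //.
have D0' : D%:~R != 0 :> padic p_pr by rewrite pchar0_intr_eq0.
apply: (mulIf D0'); rewrite mulrDl divfK // -mulrA.
rewrite -!(rmorph_int (@FracField.tofrac (padic_int p_pr))).
rewrite -(rmorph_nat (@FracField.tofrac (padic_int p_pr))) -rmorphXn -!rmorphM.
rewrite -rmorphD -(mulrA w) yD mulr1 /= -wE.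
by congr (FracField.tofrac _); rewrite addrC subrK.
Qed.

(** Approximation becomes a congruence between integers modulo [p ^ k], for
    one Dedekind sum written as a fraction that need not be reduced. *)
Lemma dedekind_sums_approximate_tofrac (p : nat) (p_pr : prime p)
    (alpha : padic_int p_pr) :
  (forall k, (0 < k)%N -> exists N D : int,
    [/\ coprimez D p, (residue alpha k * D = N %[mod (p ^ k)%N])%Z
      & dedekind_sum_values (N%:~R / D%:~R)]) ->
  dedekind_sums_approximate (FracField.tofrac alpha).
Proof.
move=> approx k k0; have [N [D [Dp alphaE SND]]] := approx k k0.
have [b bZ ->] := padic_int_approx Dp alphaE.
by exists (ratr (N%:~R / D%:~R)), b; split=> //; exists (N%:~R / D%:~R).
Qed.

Lemma coprimez_prime (D : int) (p : nat) :
  prime p -> ~~ (p %| D)%Z -> coprimez D p.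
Proof. by move=> p_pr; rewrite coprimezE coprime_sym prime_coprime. Qed.

(** * Dedekind sums near a p-adic integer *)

(** A root is a fixed point of [t |-> t ^ 2 - A (1 + t)]. This map preserves
    the multiples of [p] and contracts them by a factor [p], so that iterating
    it from 0 gains one digit at each step. *)
Lemma quadratic_root_mod (p : nat) (A : int) (k : nat) : (p %| A)%Z ->
  exists2 t : int, (p %| t)%Z & ((p ^ k)%N %| t * (t - 1) - A * (1 + t))%Z.
Proof.
move=> pA; elim: k => [|k [t pt IH]].
  by exists 0; rewrite ?dvdz0 // expn0 dvd1z.
(* [t' - t] is the polynomial at [t], and the other factor below is divisible
   by [p]. *)
exists (t ^+ 2 - A * (1 + t)).
  by rewrite rpredB // ?dvdz_mulr // expr2 dvdz_mulr.
set t' := t ^+ 2 - A * (1 + t).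
have -> : t' * (t' - 1) - A * (1 + t') =
    (t' - t) * (t' + t - A) by rewrite /t'; ring.
rewrite expnSr PoszM dvdz_mul //.
  by have -> : t' - t = t * (t - 1) - A * (1 + t) by rewrite /t'; ring.
by rewrite rpredB // rpredD // /t' rpredB ?dvdz_mulr // expr2 dvdz_mulr.
Qed.

(** With [n = t + 1], [S(1, n)] is [t (t - 1) / (t + 1)], and on the multiples
    of [p] this function of [t] takes every value of [p Z_p]. *)
Lemma dedekind_sums_approximate_pZp (p : nat) (p_pr : prime p)
    (alpha : padic_int p_pr) :
  dedekind_sums_approximate (FracField.tofrac (p%:R * alpha)).
Proof.
apply: dedekind_sums_approximate_tofrac => k k0.
have p1 := prime_gt1 p_pr.
set A := residue _ k.
have pk : (p %| (p ^ k)%N%:Z)%Z by rewrite dvdzE /= dvdn_exp.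
have pA : (p %| A)%Z.
  apply/dvdz_mod0P; have := residue_le (p%:R * alpha) k0; rewrite expn1 => ->.
  by rewrite /= residue_natr expn1 modnn mul0r mod0z.
have [t0 pt0 t0E] := quadratic_root_mod k pA.
pose n1 := (p ^ k)%N; have n1_gt0 : (0 < n1)%N by rewrite expn_gt0 ltnW.
(* Adding the modulus makes the representative positive, so that [1 < n]. *)
pose t := ((t0 %% n1)%Z + n1)%R.
have t_gt0 : 0 < t.
  by have := modz_ge0 t0 (_ : n1%:Z != 0); rewrite /t; lia.
have tE : (n1 %| t - t0)%Z.
  by rewrite -eqz_mod_dvd /t modzDr modz_mod.
have pt : (p %| t)%Z.
  by rewrite -(subrK t0 t) rpredD // (dvdz_trans pk).
exists (t * (t - 1)), (t + 1); split.
- apply: coprimez_prime => //; rewrite (rpredDl _ pt) dvdzE /= dvdn1.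
  by apply: contraTneq p1 => ->.
- apply/eqP; rewrite eq_sym eqz_mod_dvd.
  have -> : t * (t - 1) - A * (t + 1) =
      (t0 * (t0 - 1) - A * (1 + t0)) + (t - t0) * (t + t0 - 1 - A) by ring.
  by rewrite rpredD // dvdz_mulr.
- have [n nE] : exists n : nat, t + 1 = n%:Z.
    by exists (absz (t + 1)); rewrite gez0_abs //; lia.
  have n_gt0 : (0 < n)%N by lia.
  exists n, 1.
  split=> //; first lia.
    by rewrite /coprimez gcd1z.
  rewrite normalized_dedekind_sum1 //.
  have n0' : n%:R != 0 :> rat by rewrite pnatr_eq0 -lt0n.
  have -> : t = n%:Z - 1 by rewrite -nE addrK.
  by rewrite subrK rmorphM !rmorphB /= -!pmulrn; field.
Qed.

(** For the continued fraction [2 - 1 / (b - 1 / y)] with [2 b] close to 1,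
    the denominator [n] is close to -2 and the Dedekind sum to [3 y / 4 - 6];
    as 3 and 4 are units, a suitable [y] yields any given value. *)
Lemma dedekind_sums_approximate_Zp (p : nat) (p_pr : prime p)
    (alpha : padic_int p_pr) :
  (5 <= p)%N -> dedekind_sums_approximate (FracField.tofrac alpha).
Proof.
move=> p5; apply: dedekind_sums_approximate_tofrac => k k0.
set A := residue _ k.
(* From here on the power matters only through its size, its parity and its
   prime factor. *)
have [e eE] : exists e, e = (p ^ k)%N by exists (p ^ k)%N.
rewrite -eE.
have p_odd : odd p by case: (even_prime p_pr) => // p2; rewrite p2 in p5.
have e5 : (5 <= e)%N.
  by rewrite eE (leq_trans p5) // -[leqLHS]expn1 leq_pexp2l // prime_gt0.
have e_odd : odd e by rewrite eE oddX p_odd orbT.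
have [v [w vw]] : exists v w : int, 3 * v + w * e%:Z = 1.
  have [v [w vw]] := Bezoutz 3 e; exists v, w; rewrite mulrC vw.
  apply/eqP; rewrite -/(coprimez _ _) coprimezE /= eE coprimeXr //.
  by rewrite prime_coprime // dvdn_prime2 //; apply: contraTneq p5 => <-.
have e0 : e%:Z != 0 by rewrite eqz_nat; lia.
(* [3 y = 4 A + 24] modulo [e], that is [3 y / 4 - 6 = A]. *)
pose y := (`|((4 * A + 24) * v %% e)%Z|%N + e)%N.
have yE : (e %| 3 * y%:Z - (4 * A + 24))%Z.
  have yv : (e %| y%:Z - (4 * A + 24) * v)%Z.
    by rewrite -eqz_mod_dvd /y PoszD gez0_abs ?modz_ge0 // modzDr modz_mod.
  have -> : 3 * y%:Z - (4 * A + 24) =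
    3 * (y%:Z - (4 * A + 24) * v) - (4 * A + 24) * w * e.
    rewrite -mulrA; have -> : w * e%:Z = 1 - 3 * v.
      by apply/eqP; rewrite eq_sym subr_eq addrC vw.
    by ring.
  by rewrite rpredB // dvdz_mull.
have y_gt0 : (0 < y)%N by rewrite /y; lia.
pose b := (e.+1)./2; have bE : (2 * b = e + 1)%N by rewrite /b; lia.
clearbody y b.
pose m := (b * y - 1)%N; pose n := (2 * m - y)%N.
have b3y : (3 * y <= b * y)%N by rewrite leq_mul2r; lia.
have m_gt0 : (0 < m)%N by rewrite /m; nia.
have mn : (m < n)%N by rewrite /n /m; nia.
have mE : (m + 1 = b * y)%N by rewrite /m; nia.
have nmE : (n + y = 2 * m)%N by rewrite /n /m; nia.
have nE : n%:Z = e%:Z * y%:Z - 2 by rewrite /n /m; nia.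
(* The closed formula for [S(m, n)] with [b = (e + 1) / 2], over the common
   denominator [2 n]. *)
exists ((2 * y%:Z - 13 + e%:Z) * n%:Z + 2 * (e%:Z + 1)
  + (e%:Z + 1) * y%:Z - 4), (2 * n%:Z); split.
- apply: coprimez_prime => //.
  have pe : (p %| e%:Z)%Z by rewrite dvdzE /= eE dvdn_exp.
  have -> : 2 * n%:Z = 2 * y%:Z * e - 4 by rewrite nE; ring.
  rewrite rpredBl ?dvdz_mull // dvdzE /=; apply: contraL p5 => /dvdn_leq.
  by rewrite -ltnNge; apply.
- apply/eqP; rewrite eqz_mod_dvd nE.
  have -> : A * (2 * (e%:Z * y%:Z - 2)) -
      ((2 * y%:Z - 13 + e) * (e%:Z * y%:Z - 2) + 2 * (e%:Z + 1)
       + (e%:Z + 1) * y%:Z - 4) =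
      (3 * y%:Z - (4 * A + 24)) +
      (2 * A * y%:Z - (2 * y%:Z - 13 + e) * y%:Z - y%:Z) * e by ring.
  by rewrite rpredD // dvdz_mull.
- exists n, m; split.
  + by lia.
  + by rewrite ltz_nat mn.
  + exact: coprime_cfrac3 mE nmE.
  rewrite (normalized_dedekind_sum3 y_gt0 m_gt0 (ltn_trans m_gt0 mn) mE nmE).
  have bE' : b%:R = (e%:R + 1) / 2 :> rat.
    by rewrite natr1 -addn1 -bE natrM; field.
  have n0' : n%:R != 0 :> rat by rewrite pnatr_eq0; lia.
  have nR : n%:R = e%:R * y%:R - 2 :> rat.
    by have := congr1 (fun z : int => z%:~R : rat) nE;
      rewrite rmorphB rmorphM /= -!pmulrn.
  rewrite bE' !(rmorphB, rmorphD, rmorphM) /= -!pmulrn.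
  by rewrite nR in n0' *; field.
Qed.

Theorem theorem3 (p : nat) (p_pr : prime p) :
  (p = 2%N \/ p = 3%N ->
     forall a : padic p_pr, [set p%:R * b | b in padic_integers p_pr] a ->
       dedekind_sums_approximate a) /\
  ((5 <= p)%N ->
     forall a : padic p_pr, padic_integers p_pr a ->
       dedekind_sums_approximate a).
Proof.
split=> [_ a [_ [beta _ <-] <-]|p5 a [alpha _ <-]].
  rewrite -(rmorph_nat (@FracField.tofrac (padic_int p_pr))) -rmorphM.
  exact: dedekind_sums_approximate_pZp.
exact: dedekind_sums_approximate_Zp.
Qed.
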